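(* Let $V$ be a locally linearly compact vector space over a discrete field $\mathbb K$, let $\phi\colon V\to V$ be a continuous endomorphism and let $U\in\mathcal B(V)$. Then $$H(\phi,U)=\dim\frac{U^-}{\phi^{-1}U^-}.$$
   Context: $\mathbb K$ is an arbitrary field endowed with the discrete topology. A topological vector space over $\mathbb K$ is linearly topologized if it is Hausdorff and has a neighborhood basis at $0$ consisting of linear subspaces. A linear variety of $V$ is a coset $v+W$ of a linear subspace $W$; it is closed (open) if $W$ is closed (open). A linearly topologized vector space is linearly compact if every collection of closed linear varieties with the finite intersection property has non-empty intersection. A linearly topologized vector space is locally linearly compact (l.l.c.) if it has an open linear subspace that is linearly compact; $\mathcal B(V)$ denotes the family of all linearly compact open linear subspaces of $V$. ''Endomorphism'' means linear endomorphism. For a positive integer $n$ let $T_n(\phi,U)=U+\phi U+\dots+\phi^{n-1}U$, and define $H(\phi,U)=\lim_{n\to\infty}\frac1n\dim\frac{T_n(\phi,U)}{U}$ (the limit exists). Define $U^{(0)}=U$, $U^{(n+1)}=U+\phi^{-1}U^{(n)}$ for every $n\in\mathbb N$ (where $\phi^{-1}$ denotes preimage), and $U^-=\bigcup_{n\in\mathbb N}U^{(n)}$. The $U^{(n)}$ form an increasing chain, so $U^-$ is a linear subspace, and $\phi^{-1}U^-\leq U^-$. *)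

(* Defs.v *)
From HB Require Import structures.
From mathcomp Require Import all_boot all_order all_algebra.
From mathcomp Require Import all_classical all_reals.
From mathcomp Require Import topology ereal pseudometric_normed_Zmodule.

Set Implicit Arguments.
Unset Strict Implicit.
Unset Printing Implicit Defensive.

Import Order.TTheory GRing.Theory Num.Theory.

Local Open Scope classical_set_scope.
Local Open Scope ring_scope.

(* Topological vector spaces over an arbitrary field K with the discrete
   topology. The library's topologicalLmodType (tvs.v) is restricted to a
   numDomainType of scalars carrying its norm topology; HB cannot join that
   structure with the one below, so tvs.v must not be loaded before it. *)
HB.mixin Record isDiscreteTvs (K : fieldType) V
    & Topological V & GRing.Lmodule K V := {
  tvs_add_continuous : continuous (fun x : V * V => x.1 + x.2) ;
  tvs_scale_continuous :
    continuous (fun z : discrete_topology K * V => (z.1 : K) *: z.2)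
}.

#[short(type="discreteTvsType")]
HB.structure Definition DiscreteTvs (K : fieldType) :=
  {V of Topological V & GRing.Lmodule K V & isDiscreteTvs K V}.

Section LinearTopology.
Context (K : fieldType) (V : discreteTvsType K).
Implicit Types U W L A : set V.

Definition linear_subspace W : Prop := submod_closed (mem W).

Definition linearly_topologized : Prop :=
  hausdorff_space V /\
  forall N, nbhs (0 : V) N ->
    exists W, [/\ linear_subspace W, nbhs (0 : V) W & W `<=` N].

(* Closed linear varieties of the topological vector space W, a linear subspace
   of V with the induced topology. The topology of [subspace W] induces on W
   the relative topology and makes the points outside of W isolated, so for
   L `<=` W closedness in [subspace W] is closedness in W. *)
Definition closed_variety_in W A : Prop :=
  exists v L, [/\ W v, linear_subspace L, L `<=` W,
    @closed (subspace W) L & A = [set v + l | l in L]].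

Definition linearly_compact W : Prop :=
  forall C : set (set V), C `<=` closed_variety_in W ->
    finI C id -> \bigcap_(A in C) A !=set0.

(* The family B(V). *)
Definition lc_open_subspaces : set (set V) :=
  [set U | [/\ linear_subspace U, open U & linearly_compact U]].

Definition locally_linearly_compact : Prop :=
  linearly_topologized /\ lc_open_subspaces !=set0.

Definition add_set U W : set V := [set u + w | u in U & w in W].

(* The classes of the vectors b`_i form a basis of the quotient W / U. *)
Definition quotient_basis W U n (b : n.-tuple V) : Prop :=
  [/\ forall i, W (tnth b i),
      forall c : 'I_n -> K,
        U (\sum_(i < n) c i *: tnth b i) -> forall i, c i = 0
    & forall w, W w ->
        exists c : 'I_n -> K, U (w - \sum_(i < n) c i *: tnth b i)].

(* The dimension of W / U; it is +oo (the infimum of the empty set) when W / U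
   has no finite basis, and otherwise the infimum of a singleton. *)
Definition quotient_dim (R : realType) W U : \bar R :=
  ereal_inf [set (n%:R)%:E | n in
    [set n : nat | exists b : n.-tuple V, quotient_basis W U b]].

Section Entropy.
Variables (R : realType) (phi : V -> V) (U : set V).

Definition trajectory n : set V :=
  \big[add_set/[set 0]]_(i < n) (iter i phi @` U).

(* The sequence runs over the positive integers n.+1. *)
Definition entropy_seq (n : nat) : \bar R :=
  ((n.+1%:R^-1)%:E * quotient_dim R (trajectory n.+1) U)%E.

Definition entropy : \bar R := limn entropy_seq.

Fixpoint inv_stage n : set V :=
  if n is m.+1 then add_set U (phi @^-1` inv_stage m) else U.

Definition inv_hull : set V := \bigcup_n inv_stage n.

End Entropy.

End LinearTopology.

Arguments linearly_topologized {K} V.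
Arguments lc_open_subspaces {K} V.
Arguments locally_linearly_compact {K} V.

(* Main.v *)
(** Put W_n = phi^-1 (U^(n)). Since phi^-1 (A + phi B) = phi^-1 A + B, one has
    U^(n) = phi^-n (T_(n+1)), so phi^(n+1) induces an isomorphism from
    U / (U \cap W_n) onto T_(n+2) / T_(n+1). Linear compactness of U makes
    U / (U \cap W_0) finite-dimensional, so the increasing chain U \cap W_n is
    stationary and the dimensions of T_(n+2) / T_(n+1) are eventually equal to
    that of U / (U \cap \bigcup_n W_n), which is isomorphic to
    U^- / phi^-1 (U^-) because U^- = U + phi^-1 (U^-). Cesaro's theorem
    identifies this common value with H(phi, U). *)
Require Import Defs.
From HB Require Import structures.
From mathcomp Require Import all_boot all_order all_algebra finmap.
From mathcomp Require Import all_classical all_reals.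
From mathcomp Require Import topology ereal.
From mathcomp Require Import normed_module sequences.
Import GRing.Theory Num.Theory numFieldNormedType.Exports.
Local Open Scope classical_set_scope.
Local Open Scope ring_scope.

(** * Bases of quotients of linear subspaces *)

Section LinearAlgebra.
Set Implicit Arguments.
Unset Strict Implicit.
Context {K : fieldType} {V : discreteTvsType K}.
Implicit Types U W T : set V.

Lemma linear_subspaceP W : linear_subspace W <->
  [/\ W 0, forall u v, W u -> W v -> W (u + v) & forall a v, W v -> W (a *: v)].
Proof.
split=> [[W0 Wlin]|[W0 WD WZ]]; last first.
  split; first by rewrite inE.
  by move=> a u v; rewrite !inE => Wu Wv; exact/WD/Wv/WZ.
have {}W0 : W 0 by rewrite inE in W0.
have WD a u v : W u -> W v -> W (a *: u + v).
  by move=> Wu Wv; have := Wlin a u v; rewrite !inE; apply.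
split=> // [u v Wu Wv|a v Wv]; first by rewrite -[u]scale1r; exact: WD.
by rewrite -[_ *: _]addr0; exact: WD.
Qed.

Section Closure.
Variable W : set V.
Hypothesis subW : linear_subspace W.

Lemma subspace0 : W 0.
Proof. by case/linear_subspaceP: subW. Qed.

Lemma subspaceD u v : W u -> W v -> W (u + v).
Proof. by case/linear_subspaceP: subW => _ WD _; exact: WD. Qed.

Lemma subspaceZ a v : W v -> W (a *: v).
Proof. by case/linear_subspaceP: subW => _ _ WZ; exact: WZ. Qed.

Lemma subspaceN v : W v -> W (- v).
Proof. by rewrite -scaleN1r; exact: subspaceZ. Qed.

Lemma subspaceB u v : W u -> W v -> W (u - v).
Proof. by move=> Wu /subspaceN; exact: subspaceD. Qed.

Lemma subspace_sum (I : Type) (r : seq I) (P : pred I) (F : I -> V) :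
  (forall i, P i -> W (F i)) -> W (\sum_(i <- r | P i) F i).
Proof.
by move=> WF; elim/big_ind: _ => //; [exact: subspace0|exact: subspaceD].
Qed.

End Closure.

Lemma linear_subspace_preimage (f : {linear V -> V}) W :
  linear_subspace W -> linear_subspace (f @^-1` W).
Proof.
move=> subW; apply/linear_subspaceP; split=> [|u v Wu Wv|a v Wv] /=.
- by rewrite linear0; exact: subspace0.
- by rewrite linearD; exact: subspaceD.
- by rewrite linearZ; exact: subspaceZ.
Qed.

Lemma linear_subspace_image (f : {linear V -> V}) W :
  linear_subspace W -> linear_subspace (f @` W).
Proof.
move=> subW; apply/linear_subspaceP; split.
- by exists 0; [exact: subspace0|rewrite linear0].
- move=> _ _ [u Wu <-] [v Wv <-].
  by exists (u + v); [exact: subspaceD|rewrite linearD].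
- move=> a _ [v Wv <-].
  by exists (a *: v); [exact: subspaceZ|rewrite linearZ].
Qed.

Lemma linear_subspace_add U W :
  linear_subspace U -> linear_subspace W -> linear_subspace (add_set U W).
Proof.
move=> subU subW; apply/linear_subspaceP; split.
- by exists 0; [exact: subspace0|exists 0; [exact: subspace0|rewrite addr0]].
- move=> _ _ [u Uu [w Ww <-]] [u' Uu' [w' Ww' <-]].
  exists (u + u'); first exact: subspaceD.
  by exists (w + w'); [exact: subspaceD|rewrite addrACA].
- move=> a _ [u Uu [w Ww <-]].
  exists (a *: u); first exact: subspaceZ.
  by exists (a *: w); [exact: subspaceZ|rewrite scalerDr].
Qed.

Lemma linear_subspace_bigcup (W : nat -> set V) :
  (forall n, linear_subspace (W n)) -> nondecreasing_seq W ->
  linear_subspace (\bigcup_n W n).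
Proof.
move=> subW leW; apply/linear_subspaceP; split.
- by exists 0%N => //; exact: subspace0.
- move=> u v [m _ Wu] [n _ Wv]; exists (maxn m n) => //.
  apply: subspaceD => //.
    by move/subsetPset: (leW _ _ (leq_maxl m n)); apply.
  by move/subsetPset: (leW _ _ (leq_maxr m n)); apply.
- by move=> a v [n _ Wv]; exists n => //; exact: subspaceZ.
Qed.

(* As in [quotient_basis], U need not be contained in W: for subspaces this is
   about W / (W `&` U). *)
Definition quotient_span W U n (b : n.-tuple V) : Prop :=
  (forall i, W (tnth b i)) /\
  forall w, W w ->
    exists c : 'I_n -> K, U (w - \sum_(i < n) c i *: tnth b i).

(** Steinitz bound: modulo [U], the coefficients of the [b_i] over the [s_j] form an m x n matrix.
    If n < m, a nonzero row in its left kernel is a nontrivial relation among the [b_i] modulo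
    [U]. *)
Lemma quotient_span_exchange {W U m n} {b : m.-tuple V} {s : n.-tuple V} :
  linear_subspace U ->
  (forall i, W (tnth b i)) ->
  (forall c : 'I_m -> K,
     U (\sum_(i < m) c i *: tnth b i) -> forall i, c i = 0) ->
  quotient_span W U s -> (m <= n)%N.
Proof.
move=> subU Wb freeb [_ spans]; rewrite leqNgt; apply/negP => ltnm.
have /choice [A sA] : forall i, exists c : 'I_n -> K,
    U (tnth b i - \sum_(j < n) c j *: tnth s j) by move=> i; exact: spans.
pose M : 'M[K]_(m, n) := \matrix_(i, j) A i j.
have : kermx M != 0.
  by rewrite -mxrank_eq0 mxrank_ker -lt0n subn_gt0
    (leq_ltn_trans (rank_leq_col M)).
case/rowV0Pn => u /sub_kermxP uM /eqP; apply; apply/rowP => i.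
rewrite mxE; apply: (freeb (fun i => u 0 i)) => {i}.
have -> : \sum_(i < m) u 0 i *: tnth b i =
    \sum_(i < m) u 0 i *: (tnth b i - \sum_(j < n) A i j *: tnth s j).
  under [RHS]eq_bigr do rewrite scalerBr scaler_sumr.
  rewrite sumrB exchange_big /= [X in _ = _ - X]big1 ?subr0 // => j _.
  under eq_bigr do rewrite scalerA.
  rewrite -scaler_suml; have /rowP/(_ j) := uM; rewrite !mxE => uMj.
  rewrite [X in X *: _](_ : _ = 0) ?scale0r // -[RHS]uMj.
  by apply: eq_bigr => i _; rewrite mxE.
by apply: subspace_sum => // i _; exact: subspaceZ.
Qed.

Lemma quotient_basis_span W U n (b : n.-tuple V) :
  quotient_basis W U b -> quotient_span W U b.
Proof. by case. Qed.

Lemma quotient_basis_size {W U m n} {b : m.-tuple V} {s : n.-tuple V} :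
  linear_subspace U -> quotient_basis W U b -> quotient_basis W U s -> m = n.
Proof.
move=> subU qb qs; have [[Wb freeb _] [Ws frees _]] := (qb, qs).
apply/eqP; rewrite eqn_leq; apply/andP; split.
  exact: quotient_span_exchange subU Wb freeb (quotient_basis_span qs).
exact: quotient_span_exchange subU Ws frees (quotient_basis_span qb).
Qed.

Lemma quotient_dimE (R : realType) {W U n} {b : n.-tuple V} :
  linear_subspace U -> quotient_basis W U b ->
  quotient_dim R W U = (n%:R)%:E.
Proof.
move=> subU qb; rewrite /quotient_dim.
rewrite [X in ereal_inf X](_ : _ = [set (n%:R)%:E]).
  by rewrite ereal_inf1.
apply/seteqP; split=> [_ [m [s qs] <-]|_ ->]; last by exists n => //; exists b.
by rewrite (quotient_basis_size subU qs qb).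
Qed.

(** Subtracting a multiple of the relation from an expansion modulo [U] cancels the coefficient at
    [i0], at the price of holding only modulo [U']. *)
Lemma quotient_span_drop {W U U' n} {b : n.+1.-tuple V} {c : 'I_n.+1 -> K}
    {i0 : 'I_n.+1} :
  linear_subspace U' -> U `<=` U' -> quotient_span W U b ->
  U' (\sum_(i < n.+1) c i *: tnth b i) -> c i0 != 0 ->
  quotient_span W U' [tuple tnth b (lift i0 j) | j < n].
Proof.
move=> subU' leU [Wb spanb] relc ci0; split=> [i|w /spanb[d dP]].
  by rewrite tnth_mktuple.
pose a := d i0 / c i0.
exists (fun j => d (lift i0 j) - a * c (lift i0 j)).
have -> : w - \sum_(i < n) (d (lift i0 i) - a * c (lift i0 i)) *:
      tnth [tuple tnth b (lift i0 j) | j < n] i =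
    (w - \sum_(i < n.+1) d i *: tnth b i) + a *: \sum_(i < n.+1) c i *: tnth b i.
  rewrite scaler_sumr -addrA; congr (_ + _); apply: oppr_inj.
  rewrite opprK opprD opprK -sumrB (bigD1_ord i0) //= scalerA -scalerBl.
  rewrite /a divfK // subrr scale0r add0r; apply: eq_bigr => j _.
  by rewrite tnth_mktuple scalerBl scalerA.
by apply: subspaceD => //; [exact: leU|exact: subspaceZ].
Qed.

(* Take a spanning family of minimal size among those modulo any W n: a
   nontrivial relation modulo a later term would shorten it. *)
Lemma quotient_basis_chain U (W : nat -> set V) k (s : k.-tuple V) :
  (forall n, linear_subspace (W n)) -> nondecreasing_seq W ->
  quotient_span U (W 0%N) s ->
  exists N m (b : m.-tuple V),
    forall n, (N <= n)%N -> quotient_basis U (W n) b.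
Proof.
move=> subW leW spans.
have incW i j : (i <= j)%N -> W i `<=` W j by move=> ij; exact/subsetPset/leW.
pose P m := `[< exists n (b : m.-tuple V), quotient_span U (W n) b >].
have exP : exists m, P m by exists k; apply/asboolP; exists 0%N, s.
case: (ex_minnP exP) => m /asboolP[N [b spanb]] minm.
exists N, m, b => n leNn; split; first exact: spanb.1; last first.
  by move=> w /spanb.2[c cP]; exists c; exact: incW leNn _ cP.
move=> c relc i; apply/eqP/negPn/negP => ci.
case: m => [|m] in b spanb minm c relc i ci *; first by case: i ci.
suff /minm : P m by rewrite ltnn.
apply/asboolP; exists n, [tuple tnth b (lift i j) | j < m].
exact: (quotient_span_drop (subW n) (incW _ _ leNn) spanb relc ci).
Qed.

Lemma quotient_basis_exists U W k (s : k.-tuple V) :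
  linear_subspace W -> quotient_span U W s ->
  exists m (b : m.-tuple V), quotient_basis U W b.
Proof.
move=> subW spans.
have [//|N [m [b bP]]] :=
  @quotient_basis_chain U (fun=> W) k s (fun=> subW) _ spans.
by exists m, b; exact: (bP N).
Qed.

(** A relation modulo the union already holds modulo some [W n], hence modulo a term past [N], where
    [b] is free. *)
Lemma quotient_basis_bigcup U (W : nat -> set V) N m (b : m.-tuple V) :
  nondecreasing_seq W ->
  (forall n, (N <= n)%N -> quotient_basis U (W n) b) ->
  quotient_basis U (\bigcup_n W n) b.
Proof.
move=> leW bP; have [Ub _ spanb] := bP N (leqnn N); split=> //.
  move=> c [n _ relc]; have [_ freeb _] := bP _ (leq_maxl N n).
  apply: freeb; have /subsetPset := leW _ _ (leq_maxr N n); exact.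
by move=> w /spanb[c cP]; exists c; exists N.
Qed.

(** The hypotheses make [f] an isomorphism from [W1] modulo [U1] onto [W2] modulo [U2]: the
    equivalence gives well-definedness and injectivity, the last condition surjectivity. *)
Lemma quotient_basis_map (f : {linear V -> V}) (U1 W1 U2 W2 : set V) n
    (b : n.-tuple V) :
  linear_subspace U2 ->
  (forall x, W1 x -> W2 (f x)) -> (forall x, U1 x <-> U2 (f x)) ->
  (forall y, W2 y -> exists2 x, W1 x & U2 (y - f x)) ->
  quotient_basis W1 U1 b -> quotient_basis W2 U2 [tuple of map f b].
Proof.
move=> subU2 fW fU fsurj [Wb freeb spanb].
have fsum (c : 'I_n -> K) : \sum_(i < n) c i *: tnth [tuple of map f b] i =
    f (\sum_(i < n) c i *: tnth b i).
  by rewrite linear_sum; apply: eq_bigr => i _; rewrite tnth_map linearZ.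
split=> [i|c|y /fsurj[x /spanb[c cP] yx]].
- by rewrite tnth_map; exact: fW.
- by rewrite fsum => /fU; exact: freeb.
- exists c; rewrite fsum -[y](subrK (f x)) -addrA -linearB.
  by apply: subspaceD => //; exact/fU.
Qed.

(** Additivity: dim T/U = dim W/U + dim T/W. *)
Lemma quotient_basis_cat (U W T : set V) m n (b : m.-tuple V) (d : n.-tuple V) :
  linear_subspace W -> U `<=` W -> W `<=` T ->
  quotient_basis W U b -> quotient_basis T W d ->
  quotient_basis T U [tuple of b ++ d].
Proof.
move=> subW UW WT [Wb freeb spanb] [Td freed spand].
have sumE (c : 'I_(m + n) -> K) :
    \sum_(i < m + n) c i *: tnth [tuple of b ++ d] i =
    \sum_(i < m) c (lshift n i) *: tnth b i +
    \sum_(i < n) c (rshift m i) *: tnth d i.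
  rewrite big_split_ord /=; congr (_ + _); apply: eq_bigr => i _.
    by rewrite tnth_lshift.
  by rewrite tnth_rshift.
have sumW (c : 'I_m -> K) : W (\sum_(i < m) c i *: tnth b i).
  by apply: subspace_sum => // i _; exact: subspaceZ.
split.
- move=> i; case: (split_ordP i) => j ->; rewrite (tnth_lshift, tnth_rshift) //.
  exact: WT.
- move=> c; rewrite sumE => relc.
  (* Modulo [W] the part along [b] vanishes, so the coefficients of [d] are killed first. *)
  have c2 j : c (rshift m j) = 0.
    apply: (freed (fun j => c (rshift m j))).
    rewrite -[X in W X](addKr (\sum_(i < m) c (lshift n i) *: tnth b i)).
    by rewrite addrC; apply: subspaceB => //; exact: UW.
  have c1 j : c (lshift n j) = 0.
    apply: (freeb (fun j => c (lshift n j))); move: relc.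
    rewrite [X in _ + X]big1 ?addr0 // => i _; by rewrite c2 scale0r.
  by move=> i; case: (split_ordP i) => j ->.
- move=> t /spand[c2 /spanb[c1 c1P]].
  exists (fun i => match fintype.split i with inl j => c1 j | inr j => c2 j end).
  rewrite sumE (eq_bigr (fun i => c1 i *: tnth b i)); last first.
    by move=> i _; rewrite (unsplitK (inl _)).
  rewrite [X in _ - (_ + X)](eq_bigr (fun i => c2 i *: tnth d i)); last first.
    by move=> i _; rewrite (unsplitK (inr _)).
  by rewrite [X in _ - X]addrC opprD addrA.
Qed.

End LinearAlgebra.

(** * Finite codimension in linearly compact subspaces *)

Section LinearCompactness.
Context {K : fieldType} {V : discreteTvsType K}.
Implicit Types U W : set V.

(** The coset [x + W] is a neighborhood of [x], so it meets [W] as soon as [x] is adherent to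
    [W]. *)
Lemma nbhs0_subspace_closed W : linear_subspace W -> nbhs (0 : V) W -> closed W.
Proof.
move=> subW W0 x clWx.
have xB : (fun y : V => y - x) @ x --> (0 : V).
  rewrite -[X in _ --> X](subrr x).
  exact: (cvg_comp _ _ (cvg_pair cvg_id (cvg_cst (- x)))
    (tvs_add_continuous (x, - x))).
have [y [Wy /= Wyx]] := clWx _ (xB _ W0).
by rewrite -[x](subKr y); exact: subspaceB.
Qed.

(* Otherwise there are e_0, e_1, ... in U independent modulo W. Let L k be the
   sum of W and the span of the e_i, i >= k; it is open, hence closed. The
   varieties e_0 + ... + e_(k-1) + L k have the finite intersection property,
   but a common point would be a finite combination of the e_i modulo W with
   all its coefficients equal to 1. *)
Lemma linearly_compact_quotient_span U W :
  linear_subspace U -> linearly_compact U ->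
  linear_subspace W -> nbhs (0 : V) W ->
  exists n (b : n.-tuple V), quotient_span U W b.
Proof.
move=> subU lcU subW W0; apply: contrapT => infinite.
(* Since no finite family spans, every list in [U] has a further vector of [U] outside its span
   modulo [W]. The implication under [exists v] makes [next] total: 0 serves for lists not in
   [U]. *)
have /choice[next nextP] : forall s : seq V, exists v,
    (forall i, (i < size s)%N -> U s`_i) ->
    U v /\ forall c : nat -> K, ~ W (v - \sum_(i < size s) c i *: s`_i).
  move=> s; apply: contrapT => nos; apply: infinite.
  exists (size s), (in_tuple s); split.
    move=> i; rewrite (tnth_nth 0) /=.
    apply: contrapT => nUi; apply: nos; exists 0 => Us.
    by case: nUi; exact: Us.
  move=> w Uw; apply: contrapT => now; apply: nos; exists w => Us.
  split=> // c Wc.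
  apply: now; exists c.
  by under eq_bigr do rewrite (tnth_nth 0).
pose S n := iter n (fun s => rcons s (next s)) [::].
pose e n := next (S n).
have SE n : S n = mkseq e n by elim: n => //= n IHn; rewrite mkseqS -IHn.
have Ue n : U (e n).
  have [m] := ubnP n; elim: m n => // m IHm n lenm; rewrite /e SE.
  apply: (nextP _ _).1 => i; rewrite size_mkseq => ltin.
  by rewrite nth_mkseq //; apply: IHm; exact: leq_trans ltin lenm.
have We n (c : nat -> K) : ~ W (e n - \sum_(i < n) c i *: e i).
  rewrite {1}/e SE; have [i|_ /(_ c)] := nextP (mkseq e n).
    by rewrite size_mkseq => ltin; rewrite nth_mkseq.
  rewrite size_mkseq.
  by under eq_bigr => i _ do rewrite nth_mkseq //.
(* A nonzero last coefficient could be inverted, putting [e n] in the span of the earlier vectors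
   modulo [W]. *)
have freee n (c : nat -> K) : W (\sum_(i < n) c i *: e i) ->
    forall i, (i < n)%N -> c i = 0.
  elim: n => // n IHn; rewrite big_ord_recr /=.
  have [cn0|cn] := eqVneq (c n) 0.
    rewrite cn0 scale0r addr0 => /IHn ci i; rewrite ltnS leq_eqVlt.
    by case/predU1P => [->|/ci].
  move=> /(subspaceZ subW (c n)^-1) relc; exfalso.
  apply: (We n (fun i => - (c n)^-1 * c i)); move: relc.
  rewrite scalerDr scalerA mulVf // scale1r addrC scaler_sumr -sumrN.
  congr (W (_ + _)); apply: eq_bigr => i _.
  by rewrite mulNr scaleNr opprK scalerA.
(* [c] is the coordinate sequence of [x] modulo [W]. Asking for all large [n] forces [c] to vanish
   from [N] on, so no explicit support is carried along. *)
pose rep (c : nat -> K) x :=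
  exists N, forall n, (N <= n)%N -> W (x - \sum_(i < n) c i *: e i).
have repD a (c d : nat -> K) x y :
    rep c x -> rep d y -> rep (fun i => a * c i + d i) (a *: x + y).
  move=> [N cN] [M dM]; exists (maxn N M) => n; rewrite geq_max => /andP[Nn Mn].
  have := subspaceD subW (subspaceZ subW a (cN n Nn)) (dM n Mn).
  rewrite scalerBr scaler_sumr addrACA -opprD -big_split /=.
  congr (W (_ - _)); apply: eq_bigr => i _.
  by rewrite scalerDl scalerA.
have rep0 (c : nat -> K) : rep c 0 -> forall i, c i = 0.
  move=> [N cN] i; apply: (@freee (maxn N i.+1) c); last exact: leq_maxr.
  have /(subspaceN subW) := cN _ (leq_maxl N i.+1).
  by rewrite sub0r opprK.
have repe N : rep (fun i => (i < N)%:R) (\sum_(i < N) e i).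
  exists N => n leNn; rewrite (big_ord_widen _ _ leNn) big_mkcond /=.
  rewrite (eq_bigr (fun i : 'I_n => (i < N)%:R *: e i)) => [|i _].
    by rewrite subrr; exact: subspace0.
  by case: ifP; rewrite ?scale1r ?scale0r.
pose L k x := exists2 c : nat -> K, (forall i, (i < k)%N -> c i = 0) & rep c x.
have W_L k x : W x -> L k x.
  exists (fun=> 0) => //; exists 0%N => n _.
  by rewrite big1 ?subr0 // => i _; rewrite scale0r.
have subL k : linear_subspace (L k).
  split; first by rewrite inE; apply: W_L; exact: subspace0.
  move=> a x y; rewrite !inE => -[c c0 cx] [d d0 dy].
  exists (fun i => a * c i + d i); last exact: repD.
  by move=> i ltik; rewrite c0 // d0 // mulr0 addr0.
pose A k := [set \sum_(i < k) e i + l | l in U `&` L k].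
have [] := lcU (range A).
- move=> _ [k _ <-]; exists (\sum_(i < k) e i), (U `&` L k); split=> //.
  + by apply: subspace_sum => // i _.
  + apply/linear_subspaceP; split.
    * by split; exact: subspace0.
    * by move=> u v [Uu Lu] [Uv Lv]; split; exact: subspaceD.
    * by move=> a v [Uv Lv]; split; exact: subspaceZ.
  + apply/closed_subspaceP; exists (L k); last first.
      by rewrite [RHS]setIAC setIid setIC.
    apply: nbhs0_subspace_closed => //.
    by apply: filterS W0 => x; exact: W_L.
- move=> D DA.
  have /choice [idx idxP] : forall B : set V, exists k, B \in D -> B = A k.
    move=> B; have [/DA|_] := boolP (B \in D); last by exists 0%N.
    by rewrite inE => -[k _ <-]; exists k.
  (* One partial sum lies in every member of the finite family: for k <= N, removing the first k
     terms leaves e_k + ... + e_(N-1), which belongs to [L k]. *)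
  pose N := \max_(B <- D) idx B.
  exists (\sum_(i < N) e i) => B /= BD; rewrite (idxP B BD).
  have leN : (idx B <= N)%N by apply: leq_bigmax_seq.
  move: (idx B) leN => k lekN.
  exists (\sum_(i < N) e i - \sum_(i < k) e i); last by rewrite addrC subrK.
  split; first by apply: subspaceB => //; apply: subspace_sum.
  have := repD (-1) _ _ _ _ (repe k) (repe N); rewrite scaleN1r addrC => repkN.
  eexists; last exact: repkN.
  by move=> i ltik /=; rewrite ltik (leq_trans ltik lekN) mulr1 addNr.
move=> x Ax.
(* The sum in [A 0] is empty, so membership there gives coordinates [c] of [x] itself. *)
have [l0 [_ [c _ cx]] xE] := Ax _ (imageT A 0%N).
rewrite big_ord0 add0r in xE; rewrite xE in cx.
have [N cN] := cx.
(* Consecutive partial sums past the bound differ by [c N *: e N], which therefore lies in [W]. *)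
have cN0 : c N = 0.
  have := subspaceB subW (cN _ (leqnn N)) (cN _ (leqnSn N)).
  rewrite big_ord_recr /= opprB addrA addrA subrK addrAC subrr add0r => WcN.
  apply/eqP/negPn/negP => cN0; apply: (We N (fun=> 0)).
  rewrite big1 ?subr0 => [|i _]; last by rewrite scale0r.
  rewrite -[e N]scale1r -(mulVf cN0) -scalerA; exact: subspaceZ.
(* Membership in [A N.+1] makes the coordinate of index [N] equal to 1, against [cN0] and the
   uniqueness of coordinates [rep0]. *)
have [l [_ [d d0 dl]] lE] := Ax _ (imageT A N.+1).
have := repD (-1) _ _ _ _ cx (repD 1 _ _ _ _ (repe N.+1) dl).
rewrite scale1r lE scaleN1r addNr => /rep0/(_ N)/eqP.
by rewrite cN0 d0 // ltnSn mulr0 add0r mulr1 addr0 oner_eq0.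
Qed.

End LinearCompactness.

(** * Trajectories and inverse stages *)

Section Trajectory.
Context {K : fieldType} {V : discreteTvsType K}.
Variables (phi : {linear V -> V}) (U : set V).

Lemma add_setA : associative (@add_set K V).
Proof.
move=> A B C; apply/seteqP; split=> [_ [a Aa [_ [b Bb [c Cc <-]] <-]]|].
  exists (a + b); first by exists a => //; exists b.
  by exists c; rewrite ?addrA.
move=> _ [_ [a Aa [b Bb <-]] [c Cc <-]]; exists a => //.
by exists (b + c); [exists b => //; exists c|rewrite addrA].
Qed.

Lemma add0_set : left_id [set 0] (@add_set K V).
Proof.
move=> A; apply/seteqP; split=> [_ [_ -> [a Aa <-]]|a Aa]; first by rewrite add0r.
by exists 0 => //; exists a; rewrite ?add0r.
Qed.

Lemma add_set0 : right_id [set 0] (@add_set K V).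
Proof.
move=> A; apply/seteqP; split=> [_ [a Aa [_ -> <-]]|a Aa]; first by rewrite addr0.
by exists a => //; exists 0; rewrite ?addr0.
Qed.

(** This opens the iterated sum of sets in [trajectory] to the big operator lemmas. *)
HB.instance Definition _ :=
  Monoid.isLaw.Build (set V) [set 0] (@add_set K V) add_setA add0_set add_set0.

Lemma iter_linear n : linear (iter n phi).
Proof. by elim: n => // n IHn a u v; rewrite /= IHn linearP. Qed.

HB.instance Definition _ n :=
  GRing.isLinear.Build K V V *:%R (iter n phi) (iter_linear n).

Lemma trajectory1 : trajectory phi U 1 = U.
Proof. by rewrite /trajectory big_ord1 /= image_id. Qed.

Lemma trajectoryS n :
  trajectory phi U n.+1 = add_set (trajectory phi U n) (iter n phi @` U).
Proof. by rewrite /trajectory big_ord_recr. Qed.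

Hypothesis subU : linear_subspace U.

Lemma linear_subspace_trajectory n : linear_subspace (trajectory phi U n).
Proof.
elim: n => [|n IHn]; last first.
  rewrite trajectoryS; apply: linear_subspace_add => //.
  exact: linear_subspace_image.
rewrite /trajectory big_ord0; apply/linear_subspaceP; split=> //.
- by move=> _ _ -> ->; rewrite addr0.
- by move=> a _ ->; rewrite scaler0.
Qed.

Lemma trajectory_subset n : trajectory phi U n `<=` trajectory phi U n.+1.
Proof.
move=> t Tt; rewrite trajectoryS; exists t => //.
by exists 0; [exists 0; [exact: subspace0|rewrite linear0]|rewrite addr0].
Qed.

Lemma trajectory_ge n : U `<=` trajectory phi U n.+1.
Proof.
elim: n => [|n IHn]; first by rewrite trajectory1.
by move=> u /IHn; exact: trajectory_subset.
Qed.

Lemma inv_stageE n :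
  inv_stage phi U n = iter n phi @^-1` trajectory phi U n.+1.
Proof.
elim: n => [|n IHn]; first by rewrite trajectory1.
rewrite [LHS]/= IHn (trajectoryS n.+1); apply/seteqP; split.
  move=> _ [u Uu [y Ty <-]]; exists (iter n.+1 phi y).
    by rewrite iterSr.
  exists (iter n.+1 phi u); first by exists u.
  by rewrite linearD addrC.
(* Here phi^(n+1) x = t + phi^(n+1) u, so phi^(n+1) sends x - u to t in T_(n+1). *)
move=> x [t Tt [_ [u Uu <-] xE]]; exists u => //.
exists (x - u); last by rewrite addrC subrK.
suff xuE : iter n.+1 phi (x - u) = t by rewrite /= -iterSr xuE.
by rewrite [LHS]linearB; apply/eqP; rewrite subr_eq; apply/eqP/esym.
Qed.

Lemma linear_subspace_inv_stage n : linear_subspace (inv_stage phi U n).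
Proof.
elim: n => //= n IHn.
by apply: linear_subspace_add => //; exact: linear_subspace_preimage.
Qed.

Lemma inv_stage_nondecreasing : nondecreasing_seq (inv_stage phi U).
Proof.
apply/nondecreasing_seqP => n; apply/subsetPset; elim: n => [|n IHn] /=.
  move=> u Uu; exists u => //; exists 0; last by rewrite addr0.
  by rewrite /= linear0; exact: subspace0.
by move=> _ [u Uu [y Wy <-]]; exists u => //; exists y => //; exact: IHn.
Qed.

Lemma preimage_inv_stage_nondecreasing :
  nondecreasing_seq (fun n => phi @^-1` inv_stage phi U n).
Proof.
move=> m n /inv_stage_nondecreasing/subsetPset leW.
by apply/subsetPset => x; exact: leW.
Qed.

(** phi^(n+1) sends [U] onto T_(n+2) modulo T_(n+1), and by [inv_stageE] its preimage of T_(n+1) is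
    phi^-1 (U^(n)). *)
Lemma trajectory_quotient_basis n m (b : m.-tuple V) :
  quotient_basis U (phi @^-1` inv_stage phi U n) b ->
  quotient_basis (trajectory phi U n.+2) (trajectory phi U n.+1)
    [tuple of map (iter n.+1 phi) b].
Proof.
apply: quotient_basis_map; first exact: linear_subspace_trajectory.
- move=> u Uu; rewrite trajectoryS; exists 0.
    by apply: subspace0; exact: linear_subspace_trajectory.
  by exists (iter n.+1 phi u); [exists u|rewrite add0r].
- by move=> x; rewrite inv_stageE /= -iterSr.
- rewrite trajectoryS => _ [t Tt [_ [u Uu <-] <-]]; exists u => //.
  by rewrite addrK.
Qed.

(** Each U^(n) lies in U^(n+1) = U + phi^-1 (U^(n)), so [U] represents every class of U^- modulo
    phi^-1 (U^-) and the same tuple serves. *)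
Lemma inv_hull_quotient_basis m (b : m.-tuple V) :
  quotient_basis U (\bigcup_n (phi @^-1` inv_stage phi U n)) b ->
  quotient_basis (inv_hull phi U) (phi @^-1` inv_hull phi U) b.
Proof.
rewrite -preimage_bigcup -/(inv_hull phi U) => -[Ub freeb spanb].
have subH : linear_subspace (inv_hull phi U).
  apply: linear_subspace_bigcup; last exact: inv_stage_nondecreasing.
  exact: linear_subspace_inv_stage.
split=> [i||w [n _]] //; first by exists 0%N => //; exact: Ub.
have /subsetPset := inv_stage_nondecreasing (leqnSn n).
move=> /[apply] -[u /spanb[c cP] [y Wy <-]]; exists c.
rewrite addrAC; apply: subspaceD cP _; first exact: linear_subspace_preimage.
by exists n.
Qed.

(** T_(n+1) / U is filtered by the n layers T_(i+2) / T_(i+1), i < n, whose dimensions [a i] add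
    up. *)
Lemma trajectory_basis (a : nat -> nat) n :
  (forall n, exists b : (a n).-tuple V,
     quotient_basis U (phi @^-1` inv_stage phi U n) b) ->
  exists b : (\sum_(i < n) a i)%N.-tuple V,
    quotient_basis (trajectory phi U n.+1) U b.
Proof.
move=> basis_a; elim: n => [|n [b bP]].
  rewrite big_ord0 trajectory1; exists [tuple]; split=> [[]//|c _ []//|w Uw].
  by exists (fun=> 0); rewrite big_ord0 subr0.
rewrite big_ord_recr /=; have [d /trajectory_quotient_basis dP] := basis_a n.
eexists; apply: quotient_basis_cat bP dP.
- exact: linear_subspace_trajectory.
- exact: trajectory_ge.
- exact: trajectory_subset.
Qed.

End Trajectory.

(** * Passage to the limit *)

Lemma cesaro_stationary (R : realType) (a : nat -> nat) N m :
  (forall n, (N <= n)%N -> a n = m) ->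
  n.+1%:R^-1 * (\sum_(i < n) a i)%:R @[n --> \oo] --> (m%:R : R).
Proof.
(* A leading 0 turns the sum of n terms divided by n + 1 into a genuine arithmetic mean. *)
move=> aE; pose u n : R := if n is k.+1 then (a k)%:R else 0.
have uE : arithmetic_mean u = fun n => n.+1%:R^-1 * (\sum_(i < n) a i)%:R.
  apply/funext => n; rewrite /arithmetic_mean /= /series /=.
  by rewrite big_mkord big_ord_recl add0r natr_sum.
rewrite -uE; apply: cesaro; rewrite -cvg_shiftS; apply: cvg_near_cst.
by exists N => // n /aE /= ->.
Qed.

Theorem proposition5p5 (R : realType) (K : fieldType) (V : discreteTvsType K)
    (phi : {linear V -> V}) (U : set V) :
  locally_linearly_compact V -> continuous phi -> lc_open_subspaces V U ->
  cvgn (entropy_seq R phi U) /\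
  entropy R phi U =
    quotient_dim R (inv_hull phi U) (phi @^-1` inv_hull phi U).
Proof.
move=> _ cphi [subU oU lcU].
pose W n := phi @^-1` inv_stage phi U n.
have subW n : linear_subspace (W n).
  exact/linear_subspace_preimage/linear_subspace_inv_stage.
have leW : nondecreasing_seq W by exact: preimage_inv_stage_nondecreasing.
(* phi^-1 U is a neighborhood of 0 by continuity, so linear compactness of [U] yields a finite
   spanning family modulo it. *)
have W0 : nbhs (0 : V) (W 0%N).
  apply: cphi; rewrite linear0; apply: open_nbhs_nbhs; split=> //.
  exact: subspace0.
have [k [s spans]] := linearly_compact_quotient_span subU lcU (subW 0%N) W0.
have [N [m [b bP]]] := quotient_basis_chain subW leW spans.
(* [a n] is the dimension of U / (U \cap W_n), finite because [s] spans modulo [W 0], hence modulo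
   the larger [W n]. *)
have /choice[a aP] : forall n, exists k, exists b : k.-tuple V,
    quotient_basis U (W n) b.
  move=> n; apply: (@quotient_basis_exists _ _ _ _ k s) => //.
  split=> [|w /spans.2[c cP]]; first exact: spans.1.
  by exists c; have /subsetPset := leW _ _ (leq0n n); exact.
have aE n : (N <= n)%N -> a n = m.
  by move=> /bP; have [d dP] := aP n; exact: quotient_basis_size dP.
have dimE : quotient_dim R (inv_hull phi U) (phi @^-1` inv_hull phi U) = m%:R%:E.
  have subH : linear_subspace (inv_hull phi U).
    apply: linear_subspace_bigcup; first exact: linear_subspace_inv_stage.
    exact: inv_stage_nondecreasing.
  apply: quotient_dimE; first exact: linear_subspace_preimage.
  apply: inv_hull_quotient_basis => //.
  exact: quotient_basis_bigcup bP.
have cvgH : entropy_seq R phi U @ \oo --> m%:R%:E.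
  (* Index [n] stands for T_(n+1), whose quotient by [U] has n layers: the factor 1/(n+1) meets a
     sum of n terms. *)
  rewrite (_ : entropy_seq R phi U =
      fun n => (n.+1%:R^-1 * (\sum_(i < n) a i)%:R)%:E).
    by apply: cvg_EFin; [exact: nearW|exact: cesaro_stationary aE].
  apply/funext => n; have [d dP] := trajectory_basis subU n aP.
  by rewrite /entropy_seq (quotient_dimE _ subU dP) EFinM.
by split; [apply/cvg_ex; exists m%:R%:E|rewrite dimE; exact/cvg_lim].
Qed.
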